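(* Let $A$ be a positive (bounded) operator on a Hilbert space $\mathcal{H}$ and let $x\in\mathcal{H}$ with $\|x\|=1$. (i) If $Sp(A)\subset(1,\infty)$ and $r\ge2$, then $$\langle Ax,x\rangle^r\le\langle A^rx,x\rangle-\frac{r^2-r}{2}\left(\langle A^2x,x\rangle-\langle Ax,x\rangle^2\right).$$ (ii) If $Sp(A)\subset(0,1)$ and $0<r<1$, then $$\langle A^rx,x\rangle\le\langle Ax,x\rangle^r+\frac{r-r^2}{2}\left(\langle Ax,x\rangle^2-\langle A^2x,x\rangle\right).$$
   Context: Operators are bounded linear operators on a complex Hilbert space; $Sp(A)$ is the spectrum of $A$; $r$ is a real number and $A^r$ is defined by the functional calculus for self-adjoint operators. An operator $A$ is positive if it is self-adjoint and $\langle Ax,x\rangle\ge0$ for all $x\in\mathcal{H}$. *)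

(* Defs.v *)
From HB Require Import structures.
From mathcomp Require Import all_boot all_order all_algebra.
From mathcomp Require Import sesquilinear complex.
From mathcomp Require Import all_classical all_reals all_analysis.

Set Implicit Arguments.
Unset Strict Implicit.
Unset Printing Implicit Defensive.

Import Order.TTheory GRing.Theory Num.Theory.
Import numFieldNormedType.Exports.

Local Open Scope classical_set_scope.
Local Open Scope ring_scope.
Local Open Scope complex_scope.

(* A complex Hilbert space is a complete normed space over R[i] whose norm is
   the one induced by a positive definite Hermitian form; as in sesquilinear.v,
   the form is linear in its first argument and conjugate-linear in its
   second. *)
Definition induces_norm (R : realType) (V : completeNormedModType R[i])
    (dot : {dot V for @Num.conj R[i]}) : Prop :=
  forall u : V, `|u| = sqrtC (dot u u).

Definition bounded_operator (R : realType) (V : completeNormedModType R[i])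
    (T : V -> V) : Prop :=
  linear T /\ exists M : R, forall u : V, `|T u| <= M%:C * `|u|.

Definition self_adjoint (R : realType) (V : completeNormedModType R[i])
    (dot : {dot V for @Num.conj R[i]}) (T : V -> V) : Prop :=
  forall u v : V, dot (T u) v = dot u (T v).

(* The order of R[i] is partial: 0 <= z says that z is real and nonnegative. *)
Definition positive_operator (R : realType) (V : completeNormedModType R[i])
    (dot : {dot V for @Num.conj R[i]}) (T : V -> V) : Prop :=
  [/\ bounded_operator T, self_adjoint dot T & forall u : V, 0 <= dot (T u) u].

Definition spectrum (R : realType) (V : completeNormedModType R[i])
    (T : V -> V) : set R[i] :=
  [set z | ~ exists S : V -> V, [/\ bounded_operator S,
     forall u : V, S (T u - z *: u) = u & forall u : V, T (S u) - z *: S u = u]].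

Definition poly_operator (R : realType) (V : completeNormedModType R[i])
    (p : {poly R}) (T : V -> V) (u : V) : V :=
  \sum_(i < size p) (p`_i)%:C *: iter i T u.

(* Continuous functional calculus of a self-adjoint operator T: f(T) is the
   limit, in operator norm, of p_n(T), where p_n are polynomials converging to f
   uniformly on the spectrum of T. The spectrum is real, so real polynomials
   suffice for a real-valued f. For self-adjoint T and f continuous on the
   spectrum, such a limit exists and does not depend on the choice of p_n. *)
Definition is_functional_calculus (R : realType)
    (V : completeNormedModType R[i]) (T : V -> V) (f : R -> R)
    (S : V -> V) : Prop :=
  bounded_operator S /\
  exists p : nat -> {poly R},
    (forall e : R, 0 < e -> \forall n \near \oo,
       forall t : R, spectrum T t%:C -> `|(p n).[t] - f t| <= e) /\
    (forall e : R, 0 < e -> \forall n \near \oo,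
       forall u : V, `|poly_operator (p n) T u - S u| <= e%:C * `|u|).

Definition functional_calculus (R : realType)
    (V : completeNormedModType R[i]) (T : V -> V) (f : R -> R) : V -> V :=
  xget (fun=> 0) [set S | is_functional_calculus T f S].

Definition operator_powR (R : realType) (V : completeNormedModType R[i])
    (T : V -> V) (r : R) : V -> V :=
  functional_calculus T (fun t => t `^ r).

(* Main.v *)
Require Import Defs.
From HB Require Import structures.
From mathcomp Require Import all_boot all_order all_algebra.
From mathcomp Require Import sesquilinear complex.
From mathcomp Require Import all_classical all_reals all_analysis.
From mathcomp Require Import ring lra.

Set Implicit Arguments.
Unset Strict Implicit.
Unset Printing Implicit Defensive.

Import Order.TTheory GRing.Theory Num.Theory.
Import numFieldNormedType.Exports.

Local Open Scope classical_set_scope.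
Local Open Scope ring_scope.
Local Open Scope complex_scope.

(** For r >= 2 the function f(t) = t^r - (r^2 - r)/2 t^2 is convex on
    [1, +oo[, since f''(t) = (r^2 - r)(t^(r - 2) - 1); for 0 < r < 1 the function
    t^r + (r - r^2)/2 t^2 is concave on ]0, 1] for the same reason. Both parts
    are Jensen's inequality for these functions and the spectral distribution
    of A at x, whose mean is a = <Ax, x>. Jensen's inequality is in turn the
    supporting tangent at a: t^r stays on one side of a quadratic polynomial g
    on the spectrum ([powR_tangent_ge], [powR_tangent_le]), hence <A^r x, x>
    stays on the same side of <g(A)x, x>, and the linear term of g vanishes at x.

    The passage from an inequality on the spectrum to one between quadratic
    forms needs two facts.

    - A real polynomial p that is nonnegative on the spectrum of a self-adjoint
      T gives a positive p(T) ([poly_operator_ge0]). Indeed the infimum m of the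
      numerical range of p(T) belongs to the spectrum of p(T)
      ([self_adjoint_bottom]), and every point of that spectrum is a value of p
      on the spectrum of T ([spectrum_cpoly]), because p - m splits into linear
      factors over the complex numbers and inverting each of them would invert
      p(T) - m. Applied to e^2 - p^2 this bounds the norm of p(T) by any bound e
      of |p| on the spectrum ([poly_operator_norm_le]).

    - A^r really is a limit of polynomials in A
      ([functional_calculus_exists]). The spectrum lies in some [0, M], by the
      Neumann series ([spectrum_le]); t^r is a uniform limit of polynomials p_n
      on [0, M] ([weierstrass]); and the norm bound makes (p_n(A)) a Cauchy
      sequence.

    Norms and inner products take their values in R[i]; the estimates are made
    on their real parts [rnorm] and [rdot]. *)

(** * Uniform polynomial approximation *)

(** The polynomial sum_k 'C(n, k) g(k) X^k (1 - X)^(n - k), written with de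
    Casteljau's recursion: estimates then go by induction on n, without binomial
    sums. *)
Fixpoint bernstein (R : realType) (n : nat) (g : nat -> R) : {poly R} :=
  if n is m.+1 then
    (1 - 'X) * bernstein m g + 'X * bernstein m (fun k => g k.+1)
  else (g 0%N)%:P.

(** The bernstein polynomial at x is the mean of g over a binomial distribution
    with n trials, whose second moment about c is
    (n x - c)^2 + n x (1 - x). The center c is free because the recursion shifts
    it by 1. *)
Lemma bernstein_dist (R : realType) (n : nat) (g : nat -> R) (v e K c x : R) :
  0 <= x <= 1 ->
  (forall k, (k <= n)%N -> `|g k - v| <= e + K * (k%:R - c) ^+ 2) ->
  `|(bernstein n g).[x] - v| <= e + K * ((n%:R * x - c) ^+ 2 + n%:R * x * (1 - x)).
Proof.
move=> /andP[x0 x1]; elim: n g c => [|n IH] g c gv.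
  rewrite /= hornerC; apply: le_trans (gv 0%N _) _ => //.
  by rewrite !mul0r addr0.
have h0 := IH g c (fun k kn => gv k (leq_trans kn (leqnSn n))).
have h1 : `|(bernstein n (fun k => g k.+1)).[x] - v| <=
    e + K * ((n%:R * x - (c - 1)) ^+ 2 + n%:R * x * (1 - x)).
  apply: IH => k kn; apply: le_trans (gv k.+1 _) _ => //.
  by rewrite -natr1 opprB addrA addrAC.
rewrite /= hornerD !hornerM hornerD hornerN hornerX hornerC.
set p := (bernstein n g).[x] in h0 *; set q := (bernstein _ _).[x] in h1 *.
have -> : (1 - x) * p + x * q - v = (1 - x) * (p - v) + x * (q - v) by ring.
apply: le_trans (ler_normD _ _) _.
rewrite !normrM (ger0_norm x0) (@ger0_norm _ (1 - x)) ?subr_ge0//.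
apply: le_trans (lerD (ler_wpM2l _ h0) (ler_wpM2l x0 h1)) _.
  by rewrite subr_ge0.
by rewrite -natr1 le_eqVlt; apply/orP; left; apply/eqP; ring.
Qed.

(** Uniform continuity in the form that a second moment can absorb: close
    points contribute e, and for distant ones the oscillation of f is dominated
    by the square of the distance. *)
Lemma uniform_modulus (R : realType) (f : R -> R) (a b e : R) :
  a <= b -> {within `[a, b], continuous f} -> 0 < e ->
  exists2 K, 0 <= K & forall x y, a <= x <= b -> a <= y <= b ->
    `|f x - f y| <= e + K * (x - y) ^+ 2.
Proof.
move=> ab cf e0.
have : \forall d \near (0 : R)^'+, forall x, `[a, b]%classic x ->
    forall y, a <= y <= b -> `|x - y| < d -> `|f x - f y| < e.
  have := @segment_compact R a b; rewrite compact_near_coveringP -near_covering_withinP.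
  apply => x abx.
  have /cvgrPdist_lt /(_ (e / 2)) := (subspace_continuousP _ _).1 cf x abx.
  rewrite divr_gt0// => /(_ isT) [d /= d0 dP].
  have xd : \forall x' \near x & i \near (0 : R)^'+, `|x - x'| < d / 2 /\ i < d / 2.
    near=> x' i; split => //=.
      by near: x'; apply: cvgr_dist_lt; rewrite ?divr_gt0.
    by near: i; apply: nbhs_right_lt; rewrite divr_gt0.
  apply: filterS xd => -[x' i] /= [x'x id] abx' y aby x'y.
  rewrite /= in_itv/= in abx'.
  have fx' : `|f x - f x'| < e / 2.
    by apply: dP => /=; [lra|rewrite in_itv].
  have fy : `|f x - f y| < e / 2.
    apply: dP => /=; last by rewrite in_itv.
    by have := ler_distD x' x y; lra.
  by have := ler_distD (f x) (f x') (f y); rewrite (distrC (f x') (f x)); lra.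
move=> [d /= d0 dP].
have [c1 _ c1P] := EVT_max ab cf; have [c2 _ c2P] := EVT_min ab cf.
pose B := f c1 - f c2.
have fB x y : a <= x <= b -> a <= y <= b -> `|f x - f y| <= B.
  move=> abx aby; have := c1P x; have := c1P y; have := c2P x; have := c2P y.
  by rewrite !in_itv/= ler_norml /B; move=> /(_ aby) ? /(_ abx) ? /(_ aby) ? /(_ abx) ?; lra.
have B0 : 0 <= B by rewrite (le_trans _ (fB a a _ _))// lexx.
have d20 : 0 < d / 2 by rewrite divr_gt0.
exists (B / (d / 2) ^+ 2); first by rewrite divr_ge0// sqr_ge0.
move=> x y abx aby; have [xy|xy] := ltP `|x - y| (d / 2).
  apply: le_trans (ltW _) (_ : e <= _).
    have dd : ball_ Num.norm 0 d (d / 2).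
      by rewrite /= sub0r normrN gtr0_norm//; lra.
    by apply: (dP (d / 2) dd d20 x) => //; rewrite /= in_itv.
  by rewrite lerDl mulr_ge0 ?sqr_ge0// divr_ge0// sqr_ge0.
apply: le_trans (fB _ _ abx aby) _.
rewrite -[leLHS]add0r lerD ?(ltW e0)// mulrAC ler_pdivlMr ?exprn_gt0//.
by rewrite ler_wpM2l// -[leRHS]real_normK ?num_real// lerXn2r ?nnegrE// ltW.
Unshelve. all: by end_near. Qed.

(** Bernstein's proof: on [0, 1] the variance x (1 - x) / n of the sample mean
    makes the quadratic part of [uniform_modulus] negligible; the general
    interval follows by an affine change of variable. *)
Lemma weierstrass (R : realType) (f : R -> R) (a b e : R) :
  a < b -> {within `[a, b], continuous f} -> 0 < e ->
  exists p : {poly R}, forall x, a <= x <= b -> `|p.[x] - f x| <= e.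
Proof.
move=> ab cf e0.
have [|K K0 fK] := uniform_modulus (ltW ab) cf (_ : 0 < e / 2).
  by rewrite divr_gt0.
have ba0 : 0 < b - a by rewrite subr_gt0.
pose L := K * (b - a) ^+ 2.
have [n nL] : exists n : nat, 2 * L / e < n.+1%:R.
  exists (Num.truncn (2 * L / e)); exact: truncnS_gt.
pose g k := f (a + (b - a) * (k%:R / n.+1%:R)).
exists (bernstein n.+1 g \Po ((b - a)^-1 *: ('X - a%:P))) => x /andP[ax xb].
rewrite horner_comp hornerZ hornerXsubC; set y := _^-1 * _.
have xE : x = a + (b - a) * y.
  by rewrite /y mulrA divff ?gt_eqF// mul1r addrC subrK.
have y01 : 0 <= y <= 1.
  rewrite /y mulr_ge0 ?invr_ge0 ?(ltW ba0) ?subr_ge0//=.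
  by rewrite mulrC ler_pdivrMr// mul1r lerB.
have n0 : (0 : R) < n.+1%:R by [].
have := @bernstein_dist R n.+1 g (f x) (e / 2) (L / n.+1%:R ^+ 2) (n.+1%:R * y) y y01.
rewrite subrr expr0n/= add0r => h; apply: le_trans (h _) _ => [k kn|].
  have k01 : 0 <= (k%:R : R) / n.+1%:R <= 1.
    by rewrite divr_ge0//= ler_pdivrMr// mul1r ler_nat.
  case/andP: k01 => k0 k1; case/andP: (y01) => y0 y1.
  have ab' z : 0 <= z -> z <= 1 -> a <= a + (b - a) * z <= b by move=> z0 z1; nra.
  apply: le_trans (fK _ _ _ _) _; first exact: ab'.
  - by rewrite ax.
  - rewrite lerD2l {1}xE /L le_eqVlt; apply/orP; left; apply/eqP.
    by have := lt0r_neq0 n0; move: (n.+1%:R) => N N0; field.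
case/andP: y01 => y0 y1.
have -> : L / n.+1%:R ^+ 2 * (n.+1%:R * y * (1 - y)) = L / n.+1%:R * (y * (1 - y)).
  by have := lt0r_neq0 n0; move: (n.+1%:R) => N N0; field.
have L0 : 0 <= L by rewrite mulr_ge0 ?sqr_ge0.
have : L / n.+1%:R <= e / 2.
  rewrite ler_pdivrMr//; rewrite ltr_pdivrMr// in nL; nra.
have : 0 <= L / n.+1%:R by rewrite divr_ge0.
move: (L / _) => M M0 Me; nra.
Qed.

(** * Tangents and continuity of power functions *)

(** A function with nonnegative second derivative lies above its tangents, by
    the mean value theorem for f and then for its derivative. *)
Lemma tangent_le (R : realType) (f f1 f2 : R -> R) (lo hi a t : R) :
  (forall x, lo <= x <= hi -> is_derive x 1 f (f1 x)) ->
  (forall x, lo <= x <= hi -> is_derive x 1 f1 (f2 x)) ->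
  (forall x, lo <= x <= hi -> 0 <= f2 x) ->
  lo <= a <= hi -> lo <= t <= hi -> f a + f1 a * (t - a) <= f t.
Proof.
have mvt (g dg : R -> R) (x y : R) : (forall x, lo <= x <= hi -> is_derive x 1 g (dg x)) ->
    lo <= x -> x <= y -> y <= hi -> exists2 c, x <= c <= y & g y - g x = dg c * (y - x).
  move=> gdg lx xy yh.
  have [||c] := @MVT_segment R g dg x y xy.
  - move=> z; rewrite in_itv/= => /andP[xz zy]; apply: gdg.
    by rewrite (le_trans lx (ltW xz)) (le_trans (ltW zy)).
  - apply: derivable_within_continuous => z; rewrite in_itv/= => /andP[xz zy].
    apply: (@ex_derive _ _ _ _ _ _ (dg z)); apply: gdg.
    by rewrite (le_trans lx xz) (le_trans zy).
  - by rewrite in_itv/=; exists c.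
move=> df df1 f2ge0 /andP[la ah] /andP[lt th].
have f1mono x y : lo <= x -> x <= y -> y <= hi -> f1 x <= f1 y.
  move=> lx xy yh; have [c /andP[xc cy] E] := mvt _ _ _ _ df1 lx xy yh.
  rewrite -subr_ge0 E mulr_ge0 ?subr_ge0// f2ge0//.
  by rewrite (le_trans lx)// (le_trans cy).
have [at_|/ltW ta] := leP a t.
  have [c /andP[ac ct] E] := mvt _ _ _ _ df la at_ th.
  have : f1 a <= f1 c by apply: f1mono => //; exact: le_trans th.
  nra.
have [c /andP[tc ca] E] := mvt _ _ _ _ df lt ta ah.
have : f1 c <= f1 a by apply: f1mono => //; exact: le_trans lt _.
nra.
Qed.

Lemma is_derive_quad_powR (R : realType) (r b c d x : R) : 0 < x ->
  is_derive x 1 (fun t => b * t `^ r + c * t ^+ 2 + d * t)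
    (b * (r * x `^ (r - 1)) + 2 * c * x + d).
Proof.
move=> x0.
have H := is_deriveD (is_deriveD
  (is_deriveZ b (is_derive1_powR r x0)) (is_deriveZ c (is_deriveX 2 (is_derive_id x (1 : R)))))
  (is_deriveZ d (is_derive_id x (1 : R))).
apply: (is_derive_eq H).
by rewrite /GRing.scale/=; ring.
Qed.

Lemma tangent_quad_powR (R : realType) (r b c lo hi a t : R) : 0 < lo ->
  (forall x, lo <= x <= hi ->
     0 <= b * r * ((r - 1) * x `^ (r - 1 - 1)) + 2 * c) ->
  lo <= a <= hi -> lo <= t <= hi ->
  b * a `^ r + c * a ^+ 2 + (b * r * a `^ (r - 1) + 2 * c * a) * (t - a)
    <= b * t `^ r + c * t ^+ 2.
Proof.
move=> lo0 h2; pose f t := b * t `^ r + c * t ^+ 2 + 0 * t.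
pose f1 t := b * r * t `^ (r - 1) + 0 * t ^+ 2 + 2 * c * t.
have gt0 x : lo <= x <= hi -> 0 < x by case/andP=> lx _; exact: lt_le_trans lx.
have d1 x : lo <= x <= hi -> is_derive x 1 f (f1 x).
  move=> /gt0 x0; apply: (is_derive_eq (is_derive_quad_powR r b c 0 x0)).
  by rewrite /f1; ring.
have d2 x : lo <= x <= hi ->
    is_derive x 1 f1 (b * r * ((r - 1) * x `^ (r - 1 - 1)) + 2 * c).
  move=> /gt0 x0.
  apply: (is_derive_eq (is_derive_quad_powR (r - 1) (b * r) 0 (2 * c) x0)).
  by ring.
move=> la lt; have := tangent_le d1 d2 h2 la lt.
by rewrite /f /f1 !mul0r !addr0.
Qed.

(** The slope of the tangent at a of t^r - (r^2 - r)/2 t^2 is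
    r a^(r - 1) - (r^2 - r) a; convexity on [1, +oo[ is t^(r - 2) >= 1. *)
Lemma powR_tangent_ge (R : realType) (r a t : R) : 2 <= r -> 1 <= a -> 1 <= t ->
  (r ^+ 2 - r) / 2 * t ^+ 2 + (r * a `^ (r - 1) - (r ^+ 2 - r) * a) * (t - a)
    + (a `^ r - (r ^+ 2 - r) / 2 * a ^+ 2) <= t `^ r.
Proof.
move=> r2 a1 t1.
have := @tangent_quad_powR R r 1 (- ((r ^+ 2 - r) / 2)) 1 (Num.max a t) a t.
rewrite ltr01 a1 t1 !le_max !lexx orbT => /(_ isT) h.
suff /h : forall x, 1 <= x <= Num.max a t ->
    0 <= 1 * r * ((r - 1) * x `^ (r - 1 - 1)) + 2 * - ((r ^+ 2 - r) / 2).
  move=> /(_ isT isT); rewrite -subr_ge0 => H; rewrite -subr_ge0.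
  by apply: le_trans H _; rewrite le_eqVlt; apply/orP; left; apply/eqP; field.
move=> x /andP[x1 _]; have : 1 <= x `^ (r - 1 - 1).
  by rewrite -[leLHS](powRr0 x); apply: ler_powR => //; lra.
move: (_ `^ _) => y y1.
have -> : 1 * r * ((r - 1) * y) + 2 * - ((r ^+ 2 - r) / 2) = r * (r - 1) * (y - 1).
  by field.
by rewrite !mulr_ge0//; lra.
Qed.

(** The same with the signs reversed, as t^(r - 2) >= 1 on ]0, 1]. *)
Lemma powR_tangent_le (R : realType) (r a t : R) : 0 < r < 1 ->
  0 < a <= 1 -> 0 < t <= 1 ->
  t `^ r <= - ((r - r ^+ 2) / 2) * t ^+ 2
    + (r * a `^ (r - 1) + (r - r ^+ 2) * a) * (t - a)
    + (a `^ r + (r - r ^+ 2) / 2 * a ^+ 2).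
Proof.
move=> /andP[r0 r1] /andP[a0 a1] /andP[t0 t1].
have m0 : 0 < Num.min a t by rewrite lt_min a0.
have := @tangent_quad_powR R r (- 1) (- ((r - r ^+ 2) / 2)) (Num.min a t) 1 a t m0.
rewrite a1 t1 !ge_min !lexx orbT => h.
suff /h : forall x, Num.min a t <= x <= 1 ->
    0 <= - 1 * r * ((r - 1) * x `^ (r - 1 - 1)) + 2 * - ((r - r ^+ 2) / 2).
  move=> /(_ isT isT); rewrite -subr_ge0 => H; rewrite -subr_ge0.
  by apply: le_trans H _; rewrite le_eqVlt; apply/orP; left; apply/eqP; field.
move=> x /andP[mx x1]; have : 1 <= x `^ (r - 1 - 1).
  by rewrite -[leLHS](powRr0 x); apply: ger_powR; [rewrite (lt_le_trans m0)|lra].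
move: (_ `^ _) => y y1.
have -> : - 1 * r * ((r - 1) * y) + 2 * - ((r - r ^+ 2) / 2) = r * (1 - r) * (y - 1).
  by field.
by rewrite !mulr_ge0//; lra.
Qed.

Lemma powR_continuous_itv (R : realType) (r M : R) : 0 < r -> 0 < M ->
  {within `[0, M], continuous (fun t : R => t `^ r)}.
Proof.
move=> r0 M0.
have dr (x : R) : 0 < x -> derivable ((@powR R) ^~ r) x 1.
  by move=> x0; apply: derivable_powR; rewrite in_itv/= x0.
apply: derivable_oo_LRcontinuous_within; split.
- by move=> x; rewrite in_itv/= => /andP[x0 _]; exact: dr.
- by rewrite powR0 ?gt_eqF//; exact: powR_cvg0.
- apply: cvg_at_left_filter.
  have /derivable1_diffP/differentiable_continuous := dr M M0.
  exact.
Qed.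

(** * Real-valued norm and bounded operators *)

Section RealNorm.
Context (R : realType) (V : completeNormedModType R[i]).
Implicit Types (u v : V) (T : V -> V).

Definition rnorm u : R := complex.Re `|u|.

Lemma rnormE u : `|u| = (rnorm u)%:C.
Proof. by rewrite /rnorm RRe_real// ger0_real. Qed.

Lemma rnorm_ge0 u : 0 <= rnorm u.
Proof. by rewrite -ler0c -rnormE. Qed.

Lemma rnorm_eq0 u : rnorm u = 0 -> u = 0.
Proof. by move=> u0; apply/normr0_eq0; rewrite rnormE u0. Qed.

Lemma rnorm0 : rnorm 0 = 0.
Proof. by rewrite /rnorm normr0. Qed.

Lemma rnormD u v : rnorm (u + v) <= rnorm u + rnorm v.
Proof. by rewrite -lecR rmorphD/= -!rnormE ler_normD. Qed.

Lemma rnormN u : rnorm (- u) = rnorm u.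
Proof. by rewrite /rnorm normrN. Qed.

Lemma rdistC u v : rnorm (u - v) = rnorm (v - u).
Proof. by rewrite -rnormN opprB. Qed.

Lemma rdistD w u v : rnorm (u - v) <= rnorm (u - w) + rnorm (w - v).
Proof. by rewrite (le_trans _ (rnormD _ _))// addrA subrK. Qed.

Lemma rnormZ (a : R[i]) u : rnorm (a *: u) = complex.Re `|a| * rnorm u.
Proof.
have : `|a| = (complex.Re `|a|)%:C by rewrite RRe_real// ger0_real.
move: (complex.Re _) => c ac; apply: complexI.
by rewrite rmorphM/= -!rnormE normrZ ac.
Qed.

Lemma Re_norm_ge0 (a : R[i]) : 0 <= complex.Re `|a|.
Proof. by rewrite -ler0c RRe_real// ger0_real. Qed.

Lemma bounded_operatorP T : bounded_operator T <->
  linear T /\ exists2 M : R, 0 <= M & forall u, rnorm (T u) <= M * rnorm u.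
Proof.
split=> -[linT [M]]; last first.
  by move=> M0 TM; split => //; exists M => u; rewrite !rnormE -rmorphM lecR.
move=> TM; split => //; exists `|M| => // u.
rewrite (@le_trans _ _ (M * rnorm u))//.
  by rewrite -lecR rmorphM/= -!rnormE.
by rewrite ler_wpM2r ?rnorm_ge0// ler_norm.
Qed.

Lemma linear_opD T u v : linear T -> T (u + v) = T u + T v.
Proof. by move=> /(_ 1 u v); rewrite !scale1r. Qed.

Lemma linear_op0 T : linear T -> T 0 = 0.
Proof.
by move=> linT; apply: (@addrI _ (T 0)); rewrite -linear_opD// !addr0.
Qed.

Lemma linear_opZ T a u : linear T -> T (a *: u) = a *: T u.
Proof.
by move=> linT; have := linT a u 0; rewrite (linear_op0 linT) !addr0.
Qed.

Lemma linear_opB T u v : linear T -> T (u - v) = T u - T v.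
Proof.
by move=> linT; rewrite linear_opD// -scaleN1r linear_opZ// scaleN1r.
Qed.

Lemma bounded_scale a T : bounded_operator T -> bounded_operator (fun u => a *: T u).
Proof.
move=> /bounded_operatorP[linT [M M0 TM]]; apply/bounded_operatorP; split.
  by move=> b u v; rewrite linT scalerDr !scalerA mulrC.
exists (complex.Re `|a| * M) => [|u]; first by rewrite mulr_ge0// Re_norm_ge0.
by rewrite rnormZ -mulrA ler_wpM2l// Re_norm_ge0.
Qed.

Lemma bounded_add T S : bounded_operator T -> bounded_operator S ->
  bounded_operator (fun u => T u + S u).
Proof.
move=> /bounded_operatorP[linT [M M0 TM]] /bounded_operatorP[linS [N N0 SN]].
apply/bounded_operatorP; split.
  by move=> b u v; rewrite linT linS scalerDr addrACA.
exists (M + N) => [|u]; first by rewrite addr_ge0.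
by rewrite mulrDl (le_trans (rnormD _ _))// lerD.
Qed.

Lemma bounded_comp T S : bounded_operator T -> bounded_operator S ->
  bounded_operator (fun u => T (S u)).
Proof.
move=> /bounded_operatorP[linT [M M0 TM]] /bounded_operatorP[linS [N N0 SN]].
apply/bounded_operatorP; split; first by move=> b u v; rewrite linS linT.
exists (M * N) => [|u]; first by rewrite mulr_ge0.
by rewrite -mulrA (le_trans (TM _))// ler_wpM2l.
Qed.

Lemma bounded_id : bounded_operator (@id V).
Proof.
by apply/bounded_operatorP; split => //; exists 1 => // u; rewrite mul1r.
Qed.

End RealNorm.

(** * Polynomials in an operator and the spectral mapping *)

Section Polynomials.
Context (R : realType) (V : completeNormedModType R[i]) (T : V -> V).
Implicit Types (p q : {poly R[i]}) (u v : V).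

(** [poly_operator] with complex coefficients, so that polynomials split. *)
Definition cpoly_operator p u : V := \sum_(i < size p) p`_i *: iter i T u.

Lemma poly_operatorE (p : {poly R}) u :
  poly_operator p T u = cpoly_operator (map_poly (real_complex R) p) u.
Proof.
rewrite /poly_operator /cpoly_operator size_map_poly.
by apply: eq_bigr => i _; rewrite coef_map.
Qed.

Lemma cpoly_operator_widen n p u : (size p <= n)%N ->
  cpoly_operator p u = \sum_(i < n) p`_i *: iter i T u.
Proof.
move=> pn; rewrite /cpoly_operator (big_ord_widen n (fun i => p`_i *: iter i T u))//.
rewrite [RHS](bigID (fun i : 'I_n => (i < size p)%N))/= [X in _ + X]big1 ?addr0//.
by move=> i; rewrite -leqNgt => ?; rewrite nth_default// scale0r.
Qed.

Lemma cpoly_operatorD p q u :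
  cpoly_operator (p + q) u = cpoly_operator p u + cpoly_operator q u.
Proof.
rewrite (cpoly_operator_widen _ (size_polyD p q)).
rewrite (cpoly_operator_widen u (leq_maxl (size p) (size q))).
rewrite (cpoly_operator_widen u (leq_maxr (size p) (size q))) -big_split/=.
by apply: eq_bigr => i _; rewrite coefD scalerDl.
Qed.

Lemma cpoly_operatorZ c p u : cpoly_operator (c *: p) u = c *: cpoly_operator p u.
Proof.
rewrite (cpoly_operator_widen _ (size_scale_leq c p)) scaler_sumr.
by apply: eq_bigr => i _; rewrite coefZ scalerA.
Qed.

Lemma cpoly_operatorC c u : cpoly_operator c%:P u = c *: u.
Proof.
by rewrite (cpoly_operator_widen _ (size_polyC_leq1 c)) big_ord1 coefC.
Qed.

Lemma cpoly_operatorMX p u : cpoly_operator (p * 'X) u = cpoly_operator p (T u).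
Proof.
have sp : (size (p * 'X)%R <= (size p).+1)%N.
  by rewrite (leq_trans (size_polyMleq _ _))// size_polyX addn2.
rewrite (cpoly_operator_widen _ sp) big_ord_recl coefMX/= scale0r add0r.
by apply: eq_bigr => i _; rewrite coefMX /bump/= -iterSr.
Qed.

Context (bT : bounded_operator T).
Let linT : linear T := bT.1.

Lemma cpoly_operatorXM p u : cpoly_operator ('X * p) u = T (cpoly_operator p u).
Proof.
rewrite mulrC cpoly_operatorMX /cpoly_operator.
rewrite (big_morph T (fun x y => linear_opD x y linT) (linear_op0 linT)).
by apply: eq_bigr => i _; rewrite linear_opZ// -iterS iterSr.
Qed.

Lemma cpoly_operatorM p q u :
  cpoly_operator (p * q) u = cpoly_operator p (cpoly_operator q u).
Proof.
elim/poly_ind: p q u => [|p c IH] q u.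
  by rewrite mul0r -polyC0 !cpoly_operatorC !scale0r.
rewrite mulrDl -mulrA !cpoly_operatorD IH cpoly_operatorMX cpoly_operatorXM.
by rewrite mul_polyC cpoly_operatorZ cpoly_operatorC.
Qed.

Lemma bounded_cpoly p : bounded_operator (cpoly_operator p).
Proof.
elim/poly_ind: p => [|p c IH].
  have := bounded_scale 0 (@bounded_id R V).
  by congr bounded_operator; apply/funext => u; rewrite -polyC0 cpoly_operatorC.
have := bounded_add (bounded_comp IH bT) (bounded_scale c (@bounded_id R V)).
congr bounded_operator; apply/funext => u.
by rewrite cpoly_operatorD cpoly_operatorMX cpoly_operatorC.
Qed.

(** Each linear factor T - z is invertible, and the inverses compose in the
    reverse order. *)
Lemma cpoly_invertible (s : seq R[i]) : (forall z, z \in s -> ~ spectrum T z) ->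
  exists S, [/\ bounded_operator S,
    forall u, S (cpoly_operator (\prod_(z <- s) ('X - z%:P)) u) = u &
    forall u, cpoly_operator (\prod_(z <- s) ('X - z%:P)) (S u) = u].
Proof.
elim: s => [_|z s IH zs].
  exists id; split => [|u|u]; first exact: bounded_id;
  by rewrite big_nil -[1]/(1%:P) cpoly_operatorC scale1r.
have [|S' [bS' S'K KS']] := IH; first by move=> w ws; apply: zs; rewrite inE ws orbT.
have /contrapT[S [bS SK KS]] := zs z (mem_head _ _).
exists (fun u => S' (S u)); split; first exact: bounded_comp.
- move=> u; rewrite big_cons mulrDl cpoly_operatorD cpoly_operatorXM -polyCN.
  by rewrite mul_polyC cpoly_operatorZ scaleNr SK S'K.
- move=> u; rewrite big_cons mulrDl cpoly_operatorD cpoly_operatorXM -polyCN.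
  by rewrite mul_polyC cpoly_operatorZ scaleNr KS' KS.
Qed.

(** Otherwise no root of p - w would be in the spectrum of T, and
    [cpoly_invertible] would invert p(T) - w. A nonempty spectrum takes care of
    the constant p = w, which has no linear factors to invert. *)
Lemma spectrum_cpoly p w : spectrum T !=set0 ->
  spectrum (cpoly_operator p) w -> exists2 z, spectrum T z & p.[z] = w.
Proof.
move=> [z0 Tz0] spw; have pwE u :
    cpoly_operator (p - w%:P) u = cpoly_operator p u - w *: u.
  by rewrite cpoly_operatorD -polyCN cpoly_operatorC scaleNr.
have [pw|pw] := eqVneq (p - w%:P) 0.
  by exists z0 => //; apply/eqP; rewrite -subr_eq0 -[w](hornerC w z0) -hornerN -hornerD pw horner0.
apply: contrapT => noz; apply: spw.
have [s sE] := closed_field_poly_normal (p - w%:P).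
set c := lead_coef _ in sE; have c0 : c != 0 by rewrite lead_coef_eq0.
have [z zs Tz|S [bS SK KS]] := @cpoly_invertible s.
  apply: noz; exists z => //; apply/eqP; rewrite -subr_eq0 -[X in _ - X](hornerC w z).
  rewrite -hornerN -hornerD sE hornerZ mulf_eq0; apply/orP; right.
  by rewrite -[_ == 0]/(root _ z) root_prod_XsubC.
exists (fun u => S (c^-1 *: u)); split.
- exact: bounded_comp (bounded_scale _ (@bounded_id R V)).
- by move=> u; rewrite -pwE sE cpoly_operatorZ scalerA mulVf// scale1r SK.
- by move=> u; rewrite -pwE sE cpoly_operatorZ KS scalerA divff// scale1r.
Qed.

End Polynomials.

(** * Boundedness of the spectrum *)

Section Complete.
Context (R : realType) (V : completeNormedModType R[i]).
Implicit Types (u v : V) (T : V -> V).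

Lemma rcauchy_lim (u : nat -> V) (e : nat -> R) : e @ \oo --> 0 ->
  (forall n m, (n <= m)%N -> rnorm (u n - u m) <= e n) ->
  exists l, forall n, rnorm (u n - l) <= e n.
Proof.
move=> e0 ue; have cu : cvgn u.
  apply/cauchy_cvgP/cauchy_exP => d d0; have dE : d = (complex.Re d)%:C.
    by rewrite RRe_real// gtr0_real.
  have /cvgrPdist_lt/(_ (complex.Re d)) := e0.
  rewrite -ltcR -dE => /(_ d0)[N _ Ne]; exists (u N); exists N => // m /= Nm.
  rewrite -ball_normE/= rnormE dE ltcR (le_lt_trans (ue _ _ Nm))//.
  have := Ne N (leqnn N); rewrite /= sub0r normrN; apply: le_lt_trans.
  exact: ler_norm.
exists (limn u) => n; apply/ler_addgt0Pr => d d0.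
have /cvgrPdist_lt/(_ d%:C) := cu; rewrite (ltcR 0) => /(_ d0)[N _ Nu].
have := Nu (maxn n N) (leq_maxr _ _); rewrite /= rnormE ltcR => lt_d.
rewrite (le_trans (rdistD (u (maxn n N)) _ _))// lerD//.
  exact: ue _ _ (leq_maxl _ _).
by rewrite rdistC ltW.
Qed.

(** For |z| > M the equation T v - z v = u is the fixed-point equation
    v = (T v - u) / z of a contraction of ratio q = M / |z|; its iterates from 0
    are the partial sums of the Neumann series. *)
Lemma spectrum_le T M z : bounded_operator T -> 0 <= M ->
  (forall u, rnorm (T u) <= M * rnorm u) -> spectrum T z -> complex.Re `|z| <= M.
Proof.
move=> bT M0 TM sTz; rewrite leNgt; apply/negP => Mz; apply: sTz.
have linT := bT.1.
set c := complex.Re `|z| in Mz; have c0 : 0 < c by exact: le_lt_trans Mz.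
have z0 : z != 0 by apply: contraTneq c0 => z0; rewrite /c z0 normr0 ltxx.
have lin_z : linear (fun u => T u - z *: u).
  move=> a u v; rewrite linT scalerDr opprD addrACA scalerBr !scalerA.
  by rewrite (mulrC z).
have lower u : (c - M) * rnorm u <= rnorm (T u - z *: u).
  have : rnorm (z *: u) <= rnorm (T u - z *: u) + rnorm (T u).
    have := rdistD (T u) (z *: u) 0; rewrite !subr0 => h.
    by rewrite (le_trans h)// rdistC.
  by rewrite rnormZ -/c mulrBl lerBlDr => /le_trans; apply; rewrite lerD2l.
have zV : complex.Re `|z^-1| = c^-1.
  have nE (a : R[i]) : `|a| = (complex.Re `|a|)%:C by rewrite RRe_real// ger0_real.
  by apply: complexI; rewrite -nE normfV (nE z) -/c fmorphV.
(* T - z is bounded below by |z| - M, which makes the solution unique and the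
   inverse bounded; existence comes from the iterates. *)
have surj u : exists v, T v - z *: v = u.
  pose w := fix w n := if n is m.+1 then z^-1 *: (T (w m) - u) else 0.
  pose q := M / c.
  have q0 : 0 <= q by rewrite divr_ge0// ltW.
  have q1 : q < 1 by rewrite ltr_pdivrMr// mul1r.
  have contr v v' : rnorm (z^-1 *: (T v - u) - z^-1 *: (T v' - u)) <= q * rnorm (v - v').
    rewrite -scalerBr opprB addrA subrK -linear_opB// rnormZ zV ler_pdivrMl//.
    by rewrite mulrA /q mulrCA divff ?gt_eqF// mulr1.
  pose k := rnorm (w 1%N).
  have step n : rnorm (w n - w n.+1) <= k * q ^+ n.
    elim: n => [|n IH]; first by rewrite expr0 mulr1 sub0r rnormN.
    by rewrite (le_trans (contr _ _))// exprS mulrCA ler_wpM2l.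
  have k0 : 0 <= k by exact: rnorm_ge0.
  have tail n m : (n <= m)%N -> rnorm (w n - w m) <= k * (q ^+ n - q ^+ m) / (1 - q).
    move=> /subnKC <-; elim: (m - n)%N => [|j IH].
      by rewrite addn0 !subrr rnorm0 mulr0 mul0r.
    rewrite addnS (le_trans (rdistD (w (n + j)%N) _ _))//.
    rewrite (le_trans (lerD IH (step _)))// le_eqVlt; apply/orP; left; apply/eqP.
    by rewrite exprS; field; rewrite subr_eq0 gt_eqF.
  have [|n m nm|v vP] := @rcauchy_lim w (fun n => k / (1 - q) * q ^+ n).
  - have := @cvg_geometric R (k / (1 - q)) q; rewrite ger0_norm//; exact.
  - rewrite (le_trans (tail _ _ nm))// mulrAC ler_wpM2l//.
      by rewrite divr_ge0// subr_ge0 ltW.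
    by rewrite lerBlDr lerDl exprn_ge0.
  exists v; have vE : v = z^-1 *: (T v - u).
    apply/subr0_eq/rnorm_eq0/eqP; rewrite eq_le rnorm_ge0 andbT.
    apply/ler_addgt0Pr => e e0; rewrite add0r.
    have := @cvg_geometric R (k / (1 - q)) q; rewrite ger0_norm// => /(_ q1).
    move=> /cvgrPdist_lt/(_ (e / 2)); rewrite divr_gt0// => /(_ isT)[N _ NP].
    have vN n : (N <= n)%N -> rnorm (w n - v) <= e / 2.
      move=> Nn; rewrite (le_trans (vP n))//; have := NP n Nn.
      by rewrite /= sub0r normrN => /ltW; apply: le_trans; exact: ler_norm.
    rewrite (le_trans (rdistD (w N.+1) _ _))// [leRHS]splitr lerD//.
      by rewrite rdistC vN.
    rewrite (le_trans (contr _ _))// -[leRHS]mul1r ler_pM ?rnorm_ge0 ?(ltW q1)//.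
    exact: vN.
  by rewrite [in z *: v]vE scalerA divff// scale1r subKr.
have /choice[S TS] := surj.
have inj u v : T u - z *: u = T v - z *: v -> u = v.
  move=> uv; apply/subr0_eq/rnorm_eq0/eqP.
  rewrite eq_le rnorm_ge0 andbT -(pmulr_rle0 _ (_ : 0 < c - M)) ?subr_gt0//.
  by rewrite (le_trans (lower _))// (linear_opB u v lin_z) uv subrr rnorm0.
exists S; split => //; last by move=> u; apply: inj; rewrite TS.
apply/bounded_operatorP; split.
  by move=> a u v; apply: inj; rewrite TS lin_z !TS.
exists (c - M)^-1 => [|u]; first by rewrite invr_ge0 subr_ge0 ltW.
by rewrite ler_pdivlMl ?subr_gt0// (le_trans (lower _))// TS.
Qed.

End Complete.

(** * Positivity in a Hilbert space *)

Section Hilbert.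
Context (R : realType) (V : completeNormedModType R[i]).
Context (dot : {dot V for @Num.conj R[i]}) (dotV : induces_norm dot).
Implicit Types (u v : V) (T D : V -> V).

Definition rdot u v : R := complex.Re (dot u v).

Lemma dotC u v : dot u v = (dot v u)^*.
Proof. by rewrite hermC expr0 mul1r. Qed.

Lemma dotZr_real (t : R) u v : dot u (t%:C *: v) = t%:C * dot u v.
Proof. by rewrite linearZr_LR/=; congr (_ * _); exact: conjc_real. Qed.

Lemma dotuu u : dot u u = (rnorm u ^+ 2)%:C.
Proof. by rewrite rmorphXn/= -rnormE dotV sqrtCK. Qed.

Lemma rdotuu u : rdot u u = rnorm u ^+ 2.
Proof. by rewrite /rdot dotuu. Qed.

Lemma rdotC u v : rdot u v = rdot v u.
Proof. by rewrite /rdot dotC; case: (dot v u). Qed.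

Lemma rdotDl u v w : rdot (u + v) w = rdot u w + rdot v w.
Proof. by rewrite /rdot linearDl raddfD. Qed.

Lemma rdotZl (t : R) u v : rdot (t%:C *: u) v = t * rdot u v.
Proof.
by rewrite /rdot linearZl_LR /=; case: (dot u v) => a b /=; rewrite mul0r subr0.
Qed.

Lemma rdotNl u v : rdot (- u) v = - rdot u v.
Proof. by rewrite /rdot linearNl raddfN. Qed.

Lemma rdotBl u v w : rdot (u - v) w = rdot u w - rdot v w.
Proof. by rewrite rdotDl rdotNl. Qed.

Lemma rdot0l v : rdot 0 v = 0.
Proof. by rewrite /rdot linear0l. Qed.

(** Reduces bounds on imaginary parts to bounds on [rdot]. *)
Lemma Im_dot u v : complex.Im (dot u v) = rdot (- 'i *: u) v.
Proof.
rewrite /rdot linearZl_LR /=; case: (dot u v) => a b /=; ring.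
Qed.

Lemma rdot_le u v : rdot u v <= (rnorm u ^+ 2 + rnorm v ^+ 2) / 2.
Proof.
have := sqr_ge0 (rnorm (u - v)); rewrite -(rdotuu (u - v)) rdotBl.
by rewrite (rdotC u (u - v)) (rdotC v (u - v)) !rdotBl !rdotuu (rdotC v u); lra.
Qed.

(** The case of the Cauchy-Schwarz inequality in which the norm of u is at most
    e times that of v, from the arithmetic-geometric mean inequality for
    u / e and v. *)
Lemma rdot_bound (e : R) u v : 0 < e -> rnorm u <= e * rnorm v ->
  rdot u v <= e * rnorm v ^+ 2.
Proof.
move=> e0 uv; have := rdot_le (e^-1%:C *: u) v; rewrite rdotZl rnormZ.
rewrite normc_def/= expr0n addr0 sqrtr_sqr gtr0_norm ?invr_gt0// => h.
have uv' : e^-1 * rnorm u <= rnorm v by rewrite ler_pdivrMl.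
have : e^-1 * rdot u v <= rnorm v ^+ 2.
  rewrite (le_trans h)// ler_pdivrMr// mulr_natr mulr2n lerD2r.
  by rewrite lerXn2r// nnegrE ?rnorm_ge0// mulr_ge0 ?invr_ge0 ?rnorm_ge0// ltW.
by rewrite ler_pdivrMl.
Qed.

(** A positive operator nearly kills the vectors on which its quadratic form is
    small. Let L bound the form of D; expanding <D w, w> >= 0 at
    w = u - L^-1 D u leaves <D u, u> - L^-1 |D u|^2 >= 0. *)
Lemma positive_rnorm_le D : bounded_operator D -> self_adjoint dot D ->
  (forall u, 0 <= rdot (D u) u) ->
  exists2 L, 0 < L & forall u, rnorm (D u) ^+ 2 <= L * rdot (D u) u.
Proof.
move=> bD saD D0; have /bounded_operatorP[linD [K K0 DK]] := bD.
pose L := (K ^+ 2 + 1) / 2; have L0 : 0 < L.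
  by rewrite divr_gt0// ltr_wpDl// sqr_ge0.
have DL w : rdot (D w) w <= L * rnorm w ^+ 2.
  rewrite (le_trans (rdot_le _ _))// /L mulrAC ler_pM2r ?invr_gt0//.
  by rewrite mulrDl mul1r lerD2r -exprMn lerXn2r ?nnegrE ?mulr_ge0 ?rnorm_ge0.
exists L => // u.
pose s := L^-1; have sL : s * L = 1 by rewrite mulVf// gt_eqF.
have s0 : 0 < s by rewrite invr_gt0.
have Duu : rdot (D (D u)) u = rnorm (D u) ^+ 2 by rewrite -rdotuu /rdot saD.
have := D0 (u - s%:C *: D u).
rewrite linear_opB// linear_opZ// rdotBl rdotZl (rdotC (D u)) (rdotC (D (D u))).
rewrite !rdotBl !rdotZl (rdotC u (D u)) (rdotC u (D (D u))) (rdotC (D u) (D (D u))).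
rewrite Duu rdotuu; have := DL (D u).
move: (rnorm (D u) ^+ 2) (rdot _ (D u)) (rdot _ u) => x y z yLx h.
have ssy : s * (s * y) <= s * x.
  by rewrite ler_pM2l// -[leRHS]mul1r -sL -mulrA ler_pM2l.
have : s * x <= z by lra.
by rewrite ler_pdivrMl.
Qed.

(** The witness m is the infimum of the quadratic form of T on the unit sphere,
    taken as the largest lower bound so that no normalization is needed. If
    T - m had a bounded inverse, [positive_rnorm_le] would bound |u|^2 by a
    multiple of the form of T - m at u, and m + d would still be a lower bound
    for some d > 0. *)
Lemma self_adjoint_bottom T u0 : bounded_operator T -> self_adjoint dot T ->
  u0 != 0 -> exists2 m : R, spectrum T m%:C &
    forall u, m * rnorm u ^+ 2 <= rdot (T u) u.
Proof.
move=> bT saT u00; have /bounded_operatorP[linT [K K0 TK]] := bT.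
have gt0 u : u != 0 -> 0 < rnorm u ^+ 2.
  move=> u0'; rewrite exprn_gt0// lt_neqAle rnorm_ge0 andbT eq_sym.
  by apply: contra_neq u0' => /rnorm_eq0.
pose E := [set s : R | forall u, s * rnorm u ^+ 2 <= rdot (T u) u].
have supE : has_sup E.
  split.
    exists (- ((K ^+ 2 + 1) / 2)) => u.
    have := rdot_le (- T u) u; rewrite rdotNl rnormN => h.
    have : rnorm (T u) ^+ 2 <= K ^+ 2 * rnorm u ^+ 2.
      by rewrite -exprMn lerXn2r ?nnegrE ?mulr_ge0 ?rnorm_ge0.
    by lra.
  exists (rdot (T u0) u0 / rnorm u0 ^+ 2) => s /(_ u0).
  by rewrite ler_pdivlMr// gt0.
pose m := sup E.
have Em u : m * rnorm u ^+ 2 <= rdot (T u) u.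
  have [->|u0'] := eqVneq u 0.
    by rewrite rnorm0 expr0n mulr0 linear_op0// rdot0l.
  rewrite -ler_pdivlMr ?gt0//; apply: ge_sup; first by case: supE.
  by move=> s /(_ u); rewrite ler_pdivlMr// gt0.
exists m => // -[S [/bounded_operatorP[_ [N N0 SN]] SK _]].
pose D u := T u - m%:C *: u.
have bD : bounded_operator D.
  have := bounded_add bT (bounded_scale (- m%:C) (@bounded_id R V)).
  by congr bounded_operator; apply/funext => u; rewrite /D scaleNr.
have saD : self_adjoint dot D.
  move=> u v; by rewrite /D linearBl linearBr/= saT linearZl_LR dotZr_real.
have D0 u : 0 <= rdot (D u) u.
  by rewrite /D rdotBl rdotZl rdotuu subr_ge0.
have [L L0 DL] := positive_rnorm_le bD saD D0.
pose d := ((L * (N ^+ 2 + 1)))^-1.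
have d0 : 0 < d by rewrite invr_gt0 mulr_gt0// ltr_wpDl// sqr_ge0.
suff Emd : E (m + d).
  have := ub_le_sup supE.2 Emd; rewrite -/m.
  by rewrite gerDl leNgt d0.
move=> u; have := DL u; rewrite /D rdotBl rdotZl rdotuu -/(D u) => DLu.
have SDu : rnorm u ^+ 2 <= N ^+ 2 * rnorm (D u) ^+ 2.
  by rewrite -exprMn lerXn2r ?nnegrE ?mulr_ge0 ?rnorm_ge0// -[in leLHS](SK u).
rewrite mulrDl addrC -lerBrDr /d ler_pdivrMl; last first.
  by rewrite mulr_gt0// ltr_wpDl// sqr_ge0.
rewrite (le_trans SDu)// (le_trans (ler_wpM2l (sqr_ge0 _) DLu))//.
have : 0 <= L * (rdot (T u) u - m * rnorm u ^+ 2).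
  by rewrite mulr_ge0 ?subr_ge0 ?Em// ltW.
nra.
Qed.

Lemma self_adjoint_poly (p : {poly R}) T : bounded_operator T ->
  self_adjoint dot T -> self_adjoint dot (poly_operator p T).
Proof.
move=> bT saT u v; rewrite /poly_operator linear_sumlz linear_sumr.
apply: eq_bigr => i _; rewrite linearZl_LR/= dotZr_real; congr (_ * _).
by elim: (nat_of_ord i) u v => [//|n IH] u v; rewrite iterS saT iterSr IH.
Qed.


(** * Functional calculus of a self-adjoint operator *)

Section Calculus.
Context (T : V -> V) (bT : bounded_operator T) (saT : self_adjoint dot T).
Context (realT : forall z, spectrum T z -> exists t : R, z = t%:C).
Implicit Types p q : {poly R}.

Lemma spectrum_self_adjoint_neq0 (u : V) : u != 0 -> spectrum T !=set0.
Proof. by move=> /(self_adjoint_bottom bT saT)[m Tm _]; exists m%:C. Qed.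

Lemma poly_operatorD p q u :
  poly_operator (p + q) T u = poly_operator p T u + poly_operator q T u.
Proof. by rewrite !poly_operatorE rmorphD/= cpoly_operatorD. Qed.

Lemma poly_operatorC (c : R) u : poly_operator c%:P T u = c%:C *: u.
Proof. by rewrite poly_operatorE map_polyC/= cpoly_operatorC. Qed.

Lemma poly_operatorM p q u :
  poly_operator (p * q) T u = poly_operator p T (poly_operator q T u).
Proof. by rewrite !poly_operatorE rmorphM/= cpoly_operatorM. Qed.

Lemma poly_operatorZ (c : R) p u :
  poly_operator (c *: p) T u = c%:C *: poly_operator p T u.
Proof. by rewrite -mul_polyC poly_operatorM poly_operatorC. Qed.

Lemma poly_operatorX u : poly_operator 'X T u = T u.
Proof.
rewrite poly_operatorE map_polyX -['X]mulr1 cpoly_operatorXM//.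
by rewrite -[1]/(1%:P) cpoly_operatorC scale1r.
Qed.

Lemma poly_operatorN p u : poly_operator (- p) T u = - poly_operator p T u.
Proof. by rewrite -scaleN1r poly_operatorZ rmorphN1 scaleN1r. Qed.

Lemma bounded_poly p : bounded_operator (poly_operator p T).
Proof.
rewrite (_ : poly_operator p T = cpoly_operator T (map_poly (real_complex R) p)).
  exact: bounded_cpoly.
by apply/funext => u; rewrite poly_operatorE.
Qed.

(** The bottom m of the numerical range of p(T) is in the spectrum of p(T),
    hence a value of p on the spectrum of T, hence nonnegative. *)
Lemma poly_operator_ge0 p : (forall t : R, spectrum T t%:C -> 0 <= p.[t]) ->
  forall u, 0 <= rdot (poly_operator p T u) u.
Proof.
move=> p0 u; have [->|u0] := eqVneq u 0.
  by rewrite (linear_op0 (bounded_poly p).1) rdot0l.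
have [m pTm mP] := self_adjoint_bottom (bounded_poly p) (self_adjoint_poly p bT saT) u0.
apply: le_trans (mP u); rewrite mulr_ge0 ?sqr_ge0//.
have [|z Tz] := @spectrum_cpoly R V T bT (map_poly (real_complex R) p) m%:C
  (spectrum_self_adjoint_neq0 u0).
  move: pTm; congr (spectrum _ _); apply/funext => v; exact: poly_operatorE.
have [t zt] := realT Tz; rewrite zt horner_map/= => /complexI <-.
by apply: p0; rewrite -zt.
Qed.

(** Positivity of e^2 - p^2 on the spectrum reads
    <p(T) p(T) u, u> <= e^2 |u|^2, whose left-hand side is |p(T) u|^2. *)
Lemma poly_operator_norm_le (e : R) p : 0 <= e ->
  (forall t : R, spectrum T t%:C -> `|p.[t]| <= e) ->
  forall u, rnorm (poly_operator p T u) <= e * rnorm u.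
Proof.
move=> e0 pe u; rewrite -(@ler_pXn2r _ 2)// ?nnegrE ?mulr_ge0 ?rnorm_ge0//.
suff /poly_operator_ge0/(_ u) : forall t : R, spectrum T t%:C ->
    0 <= ((e ^+ 2)%:P + - (p * p)).[t].
  rewrite poly_operatorD poly_operatorN poly_operatorM poly_operatorC.
  rewrite rdotDl rdotNl rdotZl /rdot (self_adjoint_poly p bT saT) -!/(rdot _ _).
  by rewrite !rdotuu subr_ge0 exprMn.
move=> t /pe pt.
by rewrite !hornerE subr_ge0 -expr2 -real_normK ?num_real// lerXn2r ?nnegrE.
Qed.

(** Polynomials p_n with |p_n - f| <= 1 / (n + 1) on [0, M] satisfy
    |p_n(T) - p_m(T)| <= 2 / (n + 1) for n <= m, so that (p_n(T)) converges in
    operator norm. *)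
Lemma functional_calculus_exists (f : R -> R) (M : R) :
  {within `[0, M], continuous f} -> 0 < M ->
  (forall t : R, spectrum T t%:C -> 0 <= t <= M) ->
  is_functional_calculus T f (functional_calculus T f).
Proof.
move=> cf M0 sM; apply: (@xgetPex _ _ [set S | is_functional_calculus T f S]).
have /choice[p pf] : forall n, exists p : {poly R}, forall t, 0 <= t <= M ->
    `|p.[t] - f t| <= n.+1%:R^-1.
  by move=> n; apply: weierstrass.
have pp n m : (n <= m)%N -> forall t : R, spectrum T t%:C ->
    `|(p n + - p m).[t]| <= 2 * n.+1%:R^-1.
  move=> nm t /sM t0M; rewrite hornerD hornerN.
  have := ler_distD (f t) (p n).[t] (p m).[t]; have := pf n t t0M.
  have := pf m t t0M; rewrite (distrC (f t)).
  have : (m.+1%:R^-1 : R) <= n.+1%:R^-1 by rewrite lef_pV2 ?posrE// ler_nat.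
  by move: (n.+1%:R^-1) (m.+1%:R^-1) => *; lra.
have cvg0 (c : R) : (fun n => 2 * n.+1%:R^-1 * c) @ \oo --> 0.
  rewrite -(mulr0 (2 * c)) (_ : (fun n => _) = (fun n => (2 * c) * harmonic n)).
    by apply: cvgM; [exact: cvg_cst|exact: cvg_harmonic].
  by apply/funext => n; rewrite mulrAC.
have small (e : R) : 0 < e -> \forall n \near \oo, 2 * n.+1%:R^-1 <= e.
  move=> e0; have /cvgrPdist_le/(_ e e0) := cvg0 1; apply: filterS => n.
  by rewrite mulr1 sub0r normrN ger0_norm// mulr_ge0.
have /choice[S SP] : forall u, exists l, forall n,
    rnorm (poly_operator (p n) T u - l) <= 2 * n.+1%:R^-1 * rnorm u.
  move=> u; apply: rcauchy_lim => // n m nm.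
  rewrite -poly_operatorN -poly_operatorD.
  by apply: poly_operator_norm_le; [rewrite mulr_ge0|exact: pp].
exists S; split; last first.
  exists p; split=> e e0; apply: filterS (small e e0) => n ne.
    by move=> t /sM t0M; rewrite (le_trans (pf n t t0M))// (le_trans _ ne)// ler_peMl// ler1n.
  move=> u; rewrite !rnormE -rmorphM lecR (le_trans (SP u n))//.
  by rewrite ler_wpM2r// rnorm_ge0.
apply/bounded_operatorP; split.
  move=> a u v; apply/subr0_eq/rnorm_eq0/eqP; rewrite eq_le rnorm_ge0 andbT.
  pose C := rnorm (a *: u + v) + complex.Re `|a| * rnorm u + rnorm v.
  apply/ler_addgt0Pr => e e0; rewrite add0r.
  have /cvgrPdist_le/(_ e e0)[n _ /(_ n (leqnn n))] := cvg0 C.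
  rewrite /= sub0r normrN => /(le_trans (ler_norm _)); apply: le_trans.
  rewrite (le_trans (rdistD (poly_operator (p n) T (a *: u + v)) _ _))//.
  rewrite /C -addrA mulrDr lerD//; first by rewrite rdistC SP.
  rewrite (bounded_poly (p n)).1 opprD addrACA -scalerBr.
  rewrite (le_trans (rnormD _ _))// mulrDr lerD ?SP// rnormZ mulrCA.
  by rewrite ler_wpM2l ?Re_norm_ge0 ?SP.
have /bounded_operatorP[_ [K K0 pK]] := bounded_poly (p 0%N).
exists (2 + K) => [|u]; first by rewrite addr_ge0.
have := rdistD (poly_operator (p 0%N) T u) (S u) 0; rewrite !subr0 => h.
by rewrite (le_trans h)// mulrDl lerD// rdistC (le_trans (SP _ _))// invr1 mulr1.
Qed.


Lemma functional_calculus_approx (f : R -> R) S (x : V) (e : R) :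
  is_functional_calculus T f S -> 0 < e -> exists2 p : {poly R},
    forall t : R, spectrum T t%:C -> `|p.[t] - f t| <= e &
    rnorm (poly_operator p T x - S x) <= e * rnorm x.
Proof.
move=> [_ [p [pf pS]]] e0.
have [N _ Nf] := pf e e0; have [M _ MS] := pS e e0.
exists (p (maxn N M)); first exact: (Nf _ (leq_maxl _ _)).
by rewrite -lecR rmorphM/= -!rnormE; apply: MS; rewrite /= leq_maxr.
Qed.

(** The forms of the approximating p(T) are real, p(T) being self-adjoint. *)
Lemma functional_calculus_real (f : R -> R) S (x : V) :
  is_functional_calculus T f S -> complex.Im (dot (S x) x) = 0.
Proof.
move=> fS; apply/eqP; rewrite -normr_le0; apply/ler_addgt0Pr => e e0.
pose d := e / (rnorm x ^+ 2 + 1).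
have d1 : 0 < rnorm x ^+ 2 + 1 by rewrite ltr_wpDl// sqr_ge0.
have d0 : 0 < d by rewrite divr_gt0.
have [p _ pS] := functional_calculus_approx x fS d0.
set y := poly_operator p T x in pS.
have Imy : complex.Im (dot y x) = 0.
  have := dotC y x; rewrite -(self_adjoint_poly p bT saT).
  by rewrite -/y; case: (dot y x) => a b [] /=; lra.
have -> : complex.Im (dot (S x) x) = - complex.Im (dot (y - S x) x).
  by rewrite linearBl raddfB/= Imy sub0r opprK.
have Ni : complex.Re `|- 'i : R[i]| = 1.
  by rewrite normrN normc_def/= expr0n/= expr1n add0r sqrtr1.
have Nd : d * rnorm x ^+ 2 <= e.
  by rewrite /d mulrAC ler_pdivrMr// ler_wpM2l ?(ltW e0)// lerDl.
rewrite add0r normrN Im_dot ler_norml; apply/andP; split.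
  rewrite lerNl -rdotNl -scalerN (le_trans _ Nd)//.
  by apply: rdot_bound => //; rewrite rnormZ Ni mul1r rnormN.
by rewrite (le_trans _ Nd)//; apply: rdot_bound; rewrite // rnormZ Ni mul1r.
Qed.

(** If |p - f| <= d on the spectrum, then p + d - g is nonnegative there, so
    <g(T)x, x> <= <p(T)x, x> + d |x|^2; and p(T)x is within d |x| of S x. *)
Lemma functional_calculus_ge (f : R -> R) S (x : V) (g : {poly R}) :
  is_functional_calculus T f S -> (forall t : R, spectrum T t%:C -> g.[t] <= f t) ->
  rdot (poly_operator g T x) x <= rdot (S x) x.
Proof.
move=> fS gf; apply/ler_addgt0Pr => e e0.
pose d := e / (2 * (rnorm x ^+ 2 + 1)).
have d1 : 0 < 2 * (rnorm x ^+ 2 + 1) by rewrite mulr_gt0// ltr_wpDl// sqr_ge0.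
have d0 : 0 < d by rewrite divr_gt0.
have [p pf pS] := functional_calculus_approx x fS d0.
have : 0 <= rdot (poly_operator (p + d%:P - g) T x) x.
  apply: poly_operator_ge0 => t Tt; rewrite hornerD hornerN hornerD hornerC.
  by have := pf t Tt; have := gf t Tt; rewrite ler_norml => ? /andP[]; lra.
rewrite !poly_operatorD poly_operatorN poly_operatorC rdotBl rdotDl rdotZl rdotuu.
have := rdot_bound d0 pS; rewrite rdotBl.
have Nd : d * rnorm x ^+ 2 * 2 <= e.
  rewrite /d -mulrA mulrAC ler_pdivrMr// ler_wpM2l ?(ltW e0)//; lra.
lra.
Qed.

Lemma functional_calculus_le (f : R -> R) S (x : V) (g : {poly R}) :
  is_functional_calculus T f S -> (forall t : R, spectrum T t%:C -> f t <= g.[t]) ->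
  rdot (S x) x <= rdot (poly_operator g T x) x.
Proof.
move=> [bS [p [pf pS]]] fg.
have fS : is_functional_calculus T (fun t => - f t) (fun u => - S u).
  split.
    have := bounded_scale (- 1) bS.
    by congr bounded_operator; apply/funext => u; rewrite scaleN1r.
  exists (fun n => - p n); split => e e0.
    apply: filterS (pf e e0) => n pfn t Tt.
    by rewrite hornerN opprK addrC distrC; exact: pfn.
  apply: filterS (pS e e0) => n pSn u.
  by rewrite poly_operatorN opprK addrC distrC; exact: pSn.
rewrite -lerN2 -!rdotNl -poly_operatorN.
apply: (functional_calculus_ge x fS) => t Tt.
by rewrite hornerN lerN2 fg.
Qed.

(** At the unit vector x the linear term centered at a = <T x, x> vanishes: this
    is why a tangent at a yields Jensen's inequality. *)
Lemma poly_operator_quad (a b c d : R) (x : V) : rnorm x = 1 ->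
  rdot (T x) x = a ->
  rdot (poly_operator (c *: 'X^2 + b *: ('X - a%:P) + d%:P) T x) x =
  c * rdot (T (T x)) x + d.
Proof.
move=> x1 xa; rewrite !poly_operatorD !poly_operatorZ poly_operatorD poly_operatorN.
rewrite expr2 poly_operatorM !poly_operatorX !poly_operatorC.
by rewrite !rdotDl !rdotZl rdotBl rdotZl rdotuu x1 xa expr1n !mulr1 subrr mulr0 addr0.
Qed.

End Calculus.

End Hilbert.

(** * The two inequalities *)

Theorem corollary3p1 (R : realType) (V : completeNormedModType R[i])
    (dot : {dot V for @Num.conj R[i]}) (dotV : induces_norm dot)
    (A : V -> V) (Apos : positive_operator dot A)
    (x : V) (x1 : `|x| = 1) (r : R) :
  (spectrum A `<=` [set t%:C | t in `]1, +oo[] -> 2 <= r ->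
     (complex.Re (dot (A x) x) `^ r)%:C <=
     dot (operator_powR A r x) x
     - ((r ^+ 2 - r) / 2)%:C * (dot (A (A x)) x - dot (A x) x ^+ 2)) /\
  (spectrum A `<=` [set t%:C | t in `]0, 1[] -> 0 < r < 1 ->
     dot (operator_powR A r x) x <=
     (complex.Re (dot (A x) x) `^ r)%:C
     + ((r - r ^+ 2) / 2)%:C * (dot (A x) x ^+ 2 - dot (A (A x)) x)).
Proof.
have [bA saA A0] := Apos.
have nx1 : rnorm x = 1 by rewrite /rnorm x1.
set a := complex.Re _; have aE : dot (A x) x = a%:C.
  by rewrite RRe_real// ger0_real.
have aE' : rdot dot (A x) x = a by rewrite /rdot aE.
have a0 : 0 <= a by rewrite -ler0c -aE.
set b := rdot dot (A (A x)) x; have bE : dot (A (A x)) x = b%:C.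
  by rewrite /b /rdot saA dotuu.
rewrite bE aE; have [K K0 AK] := ((bounded_operatorP A).1 bA).2.
have boundA (t : R) : spectrum A t%:C -> t <= K + 1.
  move=> /(spectrum_le bA K0 AK); rewrite normc_def/= expr0n addr0 sqrtr_sqr.
  by have := ler_norm t; lra.
have calculus : 0 < r ->
    (forall z, spectrum A z -> exists2 t : R, 0 < t & z = t%:C) ->
    is_functional_calculus A (fun t => t `^ r) (operator_powR A r).
  move=> r0 Alo; apply: (@functional_calculus_exists R V dot dotV A bA saA _ _ (K + 1)).
  - by move=> z /Alo[t]; exists t.
  - by apply: powR_continuous_itv; rewrite // ltr_wpDl.
  - by rewrite ltr_wpDl.
  - move=> t At; rewrite boundA// andbT; by have [s s0 [->]] := Alo _ At; exact: ltW.
have mean (c d : R) : (forall z, spectrum A z -> exists t : R, z = t%:C) ->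
    (forall t : R, spectrum A t%:C -> 0 <= c * t + d) -> 0 <= c * a + d.
  move=> realA h; have := @poly_operator_ge0 R V dot dotV A bA saA realA (c *: 'X + d%:P) _ x.
  rewrite poly_operatorD poly_operatorZ// poly_operatorX// poly_operatorC.
  rewrite rdotDl !rdotZl rdotuu// nx1 expr1n mulr1 aE'; apply => t /h.
  by rewrite !hornerE.
split=> [A1 r2 | A01 /andP[r0 r1]].
- have A1' z : spectrum A z -> exists2 t : R, 1 < t & z = t%:C.
    by move=> /A1[t]; rewrite /= in_itv/= andbT => t1 <-; exists t.
  have realA z : spectrum A z -> exists t : R, z = t%:C.
    by move=> /A1'[t _]; exists t.
  have powA : is_functional_calculus A (fun t => t `^ r) (operator_powR A r).
    by apply: calculus => [|z /A1'[t t1]]; [lra|exists t => //; lra].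
  have a1 : 1 <= a.
    have := mean 1 (- 1) realA; rewrite mul1r subr_ge0; apply => t /A1'[s s1 [->]].
    by rewrite mul1r subr_ge0 ltW.
  pose c := (r ^+ 2 - r) / 2.
  pose g := c *: 'X^2 + (r * a `^ (r - 1) - (r ^+ 2 - r) * a) *: ('X - a%:P)
    + (a `^ r - c * a ^+ 2)%:P.
  have := functional_calculus_ge dotV bA saA realA x (g := g) powA.
  rewrite poly_operator_quad// -/b => h.
  have {}h : c * b + (a `^ r - c * a ^+ 2) <= rdot dot (operator_powR A r x) x.
    apply: h => t /A1'[s s1 [->]]; have := powR_tangent_ge r2 a1 (ltW s1).
    by rewrite !hornerE /=; congr (_ <= _); rewrite /c; field.
  rewrite (complexE (dot (operator_powR _ _ _) _)).
  rewrite (functional_calculus_real dotV bA saA x powA) -/(rdot _ _ _) -/c.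
  rewrite mulr0 addr0 -!rmorphXn -!rmorphB -rmorphM -rmorphB lecR.
  lra.
- have A01' z : spectrum A z -> exists2 t : R, 0 < t < 1 & z = t%:C.
    by move=> /A01[t]; rewrite /= in_itv/= => t01 <-; exists t.
  have realA z : spectrum A z -> exists t : R, z = t%:C.
    by move=> /A01'[t _]; exists t.
  have powA : is_functional_calculus A (fun t => t `^ r) (operator_powR A r).
    by apply: calculus => // z /A01'[t /andP[t0 _]]; exists t.
  have a1 : a <= 1.
    have := mean (- 1) 1 realA; rewrite mulN1r addrC subr_ge0.
    apply => t /A01'[s /andP[_ s1] [->]].
    by rewrite mulN1r addrC subr_ge0 ltW.
  (* If a = 0 then A x = 0 by positivity, and 0 would be an eigenvalue. *)
  have agt0 : 0 < a.
    rewrite lt_neqAle a0 andbT; apply/eqP => a00.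
    have [|L L0 AL] := @positive_rnorm_le R V dot dotV A bA saA.
      by move=> u; rewrite /rdot -ler0c RRe_real// ger0_real.
    have Ax0 : A x = 0.
      apply/rnorm_eq0/eqP; rewrite -sqrf_eq0 eq_le sqr_ge0 andbT.
      by rewrite (le_trans (AL x))// aE' -a00 mulr0.
    have : ~ spectrum A 0.
      by move=> /A01'[t /andP[t0 _]] [t0']; rewrite -t0' ltxx in t0.
    move=> /contrapT[S [bS SK _]]; have := SK x.
    rewrite scale0r subr0 Ax0 (linear_op0 bS.1) => x0.
    by move: nx1; rewrite -x0 rnorm0 => /eqP; rewrite eq_sym oner_eq0.
  pose c := (r - r ^+ 2) / 2.
  pose g := (- c) *: 'X^2 + (r * a `^ (r - 1) + (r - r ^+ 2) * a) *: ('X - a%:P)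
    + (a `^ r + c * a ^+ 2)%:P.
  have := functional_calculus_le dotV bA saA realA x (g := g) powA.
  rewrite poly_operator_quad// -/b => h.
  have {}h : rdot dot (operator_powR A r x) x <= - c * b + (a `^ r + c * a ^+ 2).
    apply: h => t /A01'[s /andP[s0 s1] [->]].
    have := @powR_tangent_le R r a s; rewrite r0 r1 agt0 a1 s0 (ltW s1).
    move=> /(_ isT isT isT).
    by rewrite !hornerE /=; congr (_ <= _); rewrite /c; field.
  rewrite (complexE (dot (operator_powR _ _ _) _)).
  rewrite (functional_calculus_real dotV bA saA x powA) -/(rdot _ _ _) -/c.
  rewrite mulr0 addr0 -!rmorphXn -!rmorphB -rmorphM -rmorphD lecR.
  lra.
Qed.
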